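(* Let $V$ be a finite-dimensional real vector space with $\dim V\ge 2$, with a symmetric invertible metric tensor $g$ of arbitrary signature. Let $R,S\in V$ with $R^2=S^2$ and $(R-S)^2=0$. For a vector $P\in V$ with $P\wedge(R-S)\ne 0$ and a real scalar $\gamma\neq-1$, the following are equivalent: (a) $\gamma^2=1-\{P\wedge(R-S)\}^2$ and the isometry $L_{P\wedge(R-S)}$ generated by the bivector $P\wedge(R-S)$ with scalar $\gamma$ satisfies the link equation $L_{P\wedge(R-S)}R=S$; (b) $$(\gamma+1)(P\cdot R-1)=(P\cdot R)(P\cdot R-P\cdot S)\qquad\text{and}\qquad \gamma^2=1+(P\cdot R-P\cdot S)^2 .$$
   Context: Notation: $A\cdot B=g(A,B)$, $A^2=A\cdot A$; $gA\in V^*$ is the covector $B\mapsto A\cdot B$; for $A\in V$, $\alpha\in V^*$, $A\otimes\alpha$ is the endomorphism $B\mapsto\alpha(B)A$. The square of a simple bivector is $(A\wedge B)^2=A^2B^2-(A\cdot B)^2$. For a simple bivector $A\wedge B$ and a real scalar $\gamma\ne -1$ with $\gamma^2=1-(A\wedge B)^2$, the isometry generated by $A\wedge B$ with scalar $\gamma$ is $$L_{A\wedge B}=\mathrm{id}+M+\frac{1}{\gamma+1}M^2,\qquad M=A\otimes gB-B\otimes gA .$$ *)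

(* Defs.v *)
From HB Require Import structures.
From mathcomp Require Import all_boot all_order all_algebra.
From mathcomp Require Import ring.

Set Implicit Arguments.
Unset Strict Implicit.
Unset Printing Implicit Defensive.

Import GRing.Theory.
Local Open Scope ring_scope.

(* [linfun f] is only meaningful when [f] is linear; the lemmas [covectorE],
   [evalE] and [tensorE] give the values of the maps defined with it. *)

Section Tensors.
Variable K : fieldType.

Definition dual (V : vectType K) : vectType K := 'Hom(V, K^o).

Definition tensor_fun (W V : vectType K) (A : V) (alpha : dual W) : W -> V :=
  fun B => alpha B *: A.

(* A (x) alpha : W -> V, for A in V and alpha in W^* *)
Definition tensor (W V : vectType K) (A : V) (alpha : dual W) : 'Hom(W, V) :=
  linfun (tensor_fun A alpha).

Definition eval_fun (V : vectType K) (A : V) : dual V -> K^o :=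
  fun alpha => alpha A.

(* The canonical embedding of V into its bidual *)
Definition eval (V : vectType K) (A : V) : dual (dual V) :=
  linfun (eval_fun A).

(* The bivector A /\ B is the antisymmetric tensor A (x) B - B (x) A, where
   V (x) V is identified with Hom(V^*, V): it maps alpha in V^* to
   alpha(B) A - alpha(A) B. *)
Definition wedge (V : vectType K) (A B : V) : 'Hom(dual V, V) :=
  tensor A (eval B) - tensor B (eval A).

Fact tensor_fun_is_linear (W V : vectType K) (A : V) (alpha : dual W) :
  linear (tensor_fun A alpha).
Proof. by move=> k x y; rewrite /tensor_fun linearP scalerDl -scalerA. Qed.

HB.instance Definition _ (W V : vectType K) (A : V) (alpha : dual W) :=
  GRing.isLinear.Build K W V _ (tensor_fun A alpha)
    (tensor_fun_is_linear A alpha).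

Fact eval_fun_is_linear (V : vectType K) (A : V) : linear (eval_fun A).
Proof. by move=> k x y; rewrite /eval_fun add_lfunE scale_lfunE. Qed.

HB.instance Definition _ (V : vectType K) (A : V) :=
  GRing.isLinear.Build K (dual V) K^o _ (eval_fun A) (eval_fun_is_linear A).

Lemma tensorE (W V : vectType K) (A : V) (alpha : dual W) (B : W) :
  tensor A alpha B = alpha B *: A.
Proof. by rewrite /tensor lfunE. Qed.

Lemma evalE (V : vectType K) (A : V) (alpha : dual V) :
  eval A alpha = alpha A.
Proof. by rewrite /eval lfunE. Qed.

Lemma wedgeE (V : vectType K) (A B : V) (alpha : dual V) :
  wedge A B alpha = alpha B *: A - alpha A *: B.
Proof. by rewrite /wedge add_lfunE opp_lfunE !tensorE !evalE. Qed.

End Tensors.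

Section Metric.
Variables (K : fieldType) (V : vectType K) (g : {symmetric V}).

(* The covector gA : B |-> g(A, B) *)
Definition covector (A : V) : dual V := linfun (g A : V -> K^o).

Lemma covectorE (A B : V) : covector A B = g A B.
Proof. by rewrite /covector lfunE. Qed.

(* The map V -> V^*, A |-> gA, is invertible. *)
Definition metric_invertible : Prop := bijective covector.

Definition sq (A : V) : K := g A A.

(* (A /\ B)^2 *)
Definition wedge_sq (A B : V) : K := sq A * sq B - g A B ^+ 2.

(* M = A (x) gB - B (x) gA *)
Definition wedge_endo (A B : V) : 'End(V) :=
  tensor A (covector B) - tensor B (covector A).

Lemma wedge_endoE (A B C : V) :
  wedge_endo A B C = g B C *: A - g A C *: B.
Proof. by rewrite /wedge_endo add_lfunE opp_lfunE !tensorE !covectorE. Qed.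

(* wedge_endo depends on A and B only through the bivector A /\ B. *)
Lemma wedge_endo_wedge (A B C : V) :
  wedge_endo A B C = wedge A B (covector C).
Proof.
by rewrite wedge_endoE wedgeE !covectorE !(hermC g C) !expr0 !mul1r.
Qed.

(* The isometry generated by A /\ B with scalar gamma; used only for
   gamma <> -1 and gamma ^+ 2 = 1 - (A /\ B)^2. *)
Definition generated_isometry (gamma : K) (A B : V) : 'End(V) :=
  let M := wedge_endo A B in (\1 + M + (gamma + 1)^-1 *: (M \o M))%VF.

Lemma generated_isometryE (gamma : K) (A B C : V) :
  generated_isometry gamma A B C =
  C + wedge_endo A B C + (gamma + 1)^-1 *: wedge_endo A B (wedge_endo A B C).
Proof.
by rewrite /generated_isometry !(add_lfunE, scale_lfunE, comp_lfunE, id_lfunE).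
Qed.

Lemma generated_isometryP (gamma : K) (A B C D : V) :
  gamma + 1 != 0 -> gamma ^+ 2 = 1 - wedge_sq A B ->
  g (generated_isometry gamma A B C) (generated_isometry gamma A B D) = g C D.
Proof.
move=> gamma1; rewrite /wedge_sq /sq => gamma2.
have {}gamma2 : g A B ^+ 2 = gamma ^+ 2 - 1 + g A A * g B B.
  by rewrite gamma2; ring.
have gC x y : g x y = g y x by rewrite (hermC g) expr0 mul1r.
rewrite !generated_isometryE !wedge_endoE.
rewrite !(linearDr, linearDl, linearNr, linearNl, linearZl_LR, linearZr_LR,
          linearBr, linearBl) /=.
rewrite ?(gC B A) ?(gC C B) ?(gC C A) ?(gC D B) ?(gC D A).
move: gamma2; move: (g A B) (g A A) (g B B) (g A C) (g A D) (g B C) (g B D).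
by move=> ab aa bb ac ad bc bd gamma2; field: gamma2.
Qed.

End Metric.

(* Main.v *)
Require Import Defs.
From HB Require Import structures.
From mathcomp Require Import all_boot all_order all_algebra.
From mathcomp Require Import reals.
From mathcomp Require Import ring.

Import GRing.Theory.
Local Open Scope ring_scope.

(** Put N = R - S. The hypotheses make N null and orthogonal to R, so
    (P /\ N)^2 = - (P.N)^2, while N is an eigenvector of the endomorphism M
    with eigenvalue - P.N and M R = - (P.R) N. Hence L R - S is a multiple
    of the nonzero vector N, with coefficient
    1 - P.R + (P.R) (P.N) / (gamma + 1). *)

Lemma wedge0r (K : fieldType) (V : vectType K) (A : V) : wedge A 0 = 0.
Proof.
by apply/lfunP => alpha; rewrite wedgeE linear0 scale0r scaler0 subrr lfunE.
Qed.

Section NullDifference.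
Variables (K : numFieldType) (V : vectType K) (g : {symmetric V}).

Lemma symmetric_formC (A B : V) : g A B = g B A.
Proof. by rewrite (hermC g) expr0 mul1r. Qed.

(** With equal squares, [(R - S)^2] expands to [2 (R^2 - R.S)], which is twice [(R - S).R]; the
    factor 2 cancels in characteristic 0. *)
Lemma null_sub_orthogonal (R S : V) :
  sq g R = sq g S -> sq g (R - S) = 0 -> g (R - S) R = 0.
Proof.
rewrite /sq => eqRS; rewrite !(linearBl, linearBr) /= -eqRS (symmetric_formC R S).
move=> null0; apply: (mulfI (x := 2%:R)); first by rewrite Num.Theory.pnatr_eq0.
by rewrite mulr0 -null0; ring.
Qed.

Lemma generated_isometry_null (gamma : K) (P N R : V) :
  sq g N = 0 -> g N R = 0 ->
  generated_isometry g gamma P N R =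
  R - (g P R - (gamma + 1)^-1 * (g P R * g P N)) *: N.
Proof.
rewrite /sq => NN NR; rewrite generated_isometryE.
have -> : wedge_endo g P N R = - g P R *: N.
  by rewrite wedge_endoE NR scale0r sub0r scaleNr.
(* Second application of M: as N is null, [M N = - (P.N) N]. *)
rewrite [wedge_endo g P N (_ *: _)]linearZ /= wedge_endoE NN scale0r sub0r.
by rewrite -scaleNr !scalerA -addrA -scalerDl -scaleNr; congr (_ + _ *: _); ring.
Qed.

End NullDifference.

Theorem mainTheorem2 (K : realType) (V : vectType K) (g : {symmetric V})
    (hdim : (2 <= \dim {:V})%N) (hg : metric_invertible g)
    (R S : V) (hRS : sq g R = sq g S) (hnull : sq g (R - S) = 0)
    (P : V) (hP : wedge P (R - S) <> 0)
    (gamma : K) (hgamma : gamma <> -1) :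
  (gamma ^+ 2 = 1 - wedge_sq g P (R - S) /\
   generated_isometry g gamma P (R - S) R = S)
  <->
  ((gamma + 1) * (g P R - 1) = g P R * (g P R - g P S) /\
   gamma ^+ 2 = 1 + (g P R - g P S) ^+ 2).
Proof.
have N0 : R - S != 0 by apply/eqP => N0; apply: hP; rewrite N0 wedge0r.
have g1 : gamma + 1 != 0 by rewrite addr_eq0; apply/eqP.
have NR := null_sub_orthogonal _ _ _ _ _ hRS hnull.
rewrite (generated_isometry_null _ _ _ _ _ _ _ hnull NR).
(* Since [P.N = P.R - P.S], the conditions on [gamma ^+ 2] in (a) and (b) become identical; only the
   link equation remains to be compared. *)
rewrite /wedge_sq hnull mulr0 sub0r opprK linearBr /=.
move: (g P R : K) (g P S : K) => p s.
set c := p - _ * _.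
(* The link equation amounts to [(1 - c) N = 0] with N nonzero. *)
have link : R - c *: (R - S) = S <-> c = 1.
  split=> [|->]; last by rewrite scale1r opprB addrC subrK.
  move/eqP; rewrite subr_eq addrC -subr_eq -[X in X == _]scale1r -subr_eq0.
  by rewrite -scalerBl scaler_eq0 subr_eq0 (negPf N0) orbF => /eqP.
suff c1 : c = 1 <-> (gamma + 1) * (p - 1) = p * (p - s) by tauto.
(* For the converse, substituting for [p * (p - s)] in [c] cancels [gamma + 1] and leaves
   [p - (p - 1)]. *)
rewrite /c; split=> [c1|<-]; last by rewrite mulKf // opprB addrC subrK.
have -> : p - 1 = (gamma + 1)^-1 * (p * (p - s)).
  by rewrite -[in LHS]c1 opprB addrC subrK.
by rewrite mulVKf.
Qed.
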